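(* Let $f:\mathbb{R}^2\to\mathbb{R}^2$ be $C^1$. Let $R$ be a connected component of $\mathbb{R}^2\setminus f^{-1}(f(S)\cup C(f,\infty))$ and let $\Omega$ be a connected component of $\mathbb{R}^2\setminus(f(S)\cup C(f,\infty))$ such that $f(z)\in\Omega$ for some $z\in R$. Let $w\in\partial\Omega$ satisfy: (i) $w\notin C(f|_R,\infty)$; (ii) $f^{-1}(w)\cap\partial R\cap S=\varnothing$; (iii) $f^{-1}(w)\cap\partial R\neq\varnothing$; and (iv) for each $\zeta\in f^{-1}(w)\cap\partial R$ there is a neighborhood $U_\zeta$ of $\zeta$ with $f(U_\zeta\setminus R)\cap\Omega=\varnothing$. Then $w$ has exactly $\mathrm{Val}(f|_R,\Omega)$ distinct preimages on $\partial R$.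
   Context: Write $f=(u,v)$; $J_f=u_xv_y-u_yv_x$ and $S=\{z\in\mathbb{R}^2: J_f(z)=0\}$. For a function $g$ defined on a set $D\subseteq\mathbb{R}^2$, $C(g,\infty)$ is the set of finite points $\zeta$ for which there is a sequence $(z_n)\subset D$ with $|z_n|\to\infty$ and $g(z_n)\to\zeta$. For $W\subseteq\mathbb{R}^2$, $\mathrm{Val}(f|_R,W)=\sup_{w\in W}\#\{z\in R: f(z)=w\}$. *)

(* Defs.v *)
From HB Require Import structures.
From mathcomp Require Import all_boot all_order all_algebra.
From mathcomp Require Import all_classical all_reals all_analysis.
Set Implicit Arguments. Unset Strict Implicit. Unset Printing Implicit Defensive.
Import Order.TTheory GRing.Theory Num.Theory.
Import numFieldNormedType.Exports.
Local Open Scope classical_set_scope.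
Local Open Scope ring_scope.

Section Plane.
Variable R : realType.
Notation P := (R * R)%type.

Definition dx (f : P -> P) (z : P) : P := 'D_((1:R), (0:R)) f z.
Definition dy (f : P -> P) (z : P) : P := 'D_((0:R), (1:R)) f z.

Definition C1 (f : P -> P) : Prop :=
  (forall z, differentiable f z) /\ continuous (dx f) /\ continuous (dy f).

Definition jac (f : P -> P) (z : P) : R :=
  (dx f z).1 * (dy f z).2 - (dy f z).1 * (dx f z).2.

Definition crit (f : P -> P) : set P := [set z | jac f z = 0].

Definition cluster_infty (g : P -> P) (D : set P) : set P :=
  [set zeta | exists u : nat -> P,
     (forall n, D (u n)) /\
     (forall M : R, \forall n \near \oo, M < `|u n|) /\
     (g \o u) @ \oo --> zeta].

Definition boundary (A : set P) : set P := closure A `\` interior A.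

Definition is_component (X C : set P) : Prop :=
  exists x, X x /\ C = connected_component X x.

End Plane.

Definition ecard {R : realType} {T : Type} (A : set T) : \bar R :=
  match pselect (finite_set A) with
  | left fA => ((projT1 (cid fA))%:R)%:E
  | right _ => +oo%E
  end.

Definition Val {R : realType} (g : R * R -> R * R) (D W : set (R * R)) : \bar R :=
  ereal_sup [set (ecard (D `&` (g @^-1` [set w])) : \bar R) | w in W].

(* Main.v *)
Require Import Defs.
From HB Require Import structures.
From mathcomp Require Import all_boot all_order all_algebra.
From mathcomp Require Import all_classical all_reals all_analysis.
From mathcomp Require Import ring lra.
Import Order.TTheory GRing.Theory Num.Theory.
Import numFieldNormedType.Exports.
Local Open Scope classical_set_scope.
Local Open Scope ring_scope.

(* Call [E] the union of the critical values and the cluster set at infinity; it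
   is closed.  For a set [D] and a point [w] outside C(f|_D, oo) all of whose
   preimages in the closure of [D] are regular, these preimages are finite in
   number, near each of them [f] is a local homeomorphism, and by compactness
   every preimage in [D] of a point close to [w] is close to one of them.  If,
   near these preimages, points outside [D] are not sent into [W], then every
   point of [W] close to [w] has exactly as many preimages in [D] as [w] has in
   the closure of [D].  At points of Omega this makes the number of preimages in
   [Rg] locally constant, hence constant; at the boundary point [w] it identifies
   that constant with the number of preimages of [w] on the boundary of [Rg]. *)

(** * Strict differentiability of a C1 map of the plane *)

Lemma derive_pair {R : realType} (f : R * R -> R * R) (x v : R * R) :
  differentiable f x -> 'D_v f x = v.1 *: dx f x + v.2 *: dy f x.
Proof.
move=> df; rewrite /dx /dy !deriveE// -!linearZ -linearD; congr ('d f x _).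
case: v => a b; congr (_, _) => /=.
  by rewrite -[_ *: 1]/(a * 1) -[_ *: 0]/(b * 0) mulr1 mulr0 addr0.
by rewrite -[_ *: 1]/(b * 1) -[_ *: 0]/(a * 0) mulr1 mulr0 add0r.
Qed.

(* [p] stands for either of the two coordinate projections. *)
Lemma is_derive_line {R : realType} (p : R * R -> R) (f : R * R -> R * R)
    (y v : R * R) (t : R) :
  continuous p -> (forall a u w, p (a *: (u - w)) = a * (p u - p w)) ->
  differentiable f (y + t *: v) ->
  is_derive t 1 (fun s => p (f (y + s *: v))) (p ('D_v f (y + t *: v))).
Proof.
move=> cp lp df.
have cv : h^-1 *: (p (f (y + (h *: 1 + t) *: v)) - p (f (y + t *: v)))
    @[h --> 0^'] --> p ('D_v f (y + t *: v)).
  have := diff_derivable (v := v) df; rewrite /derivable => d1.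
  have := cvg_comp _ _ d1 (cp _).
  apply: cvg_trans; apply: near_eq_cvg; near=> h => /=.
  rewrite lp; congr (_ * (p (f _) - _)).
  by rewrite [h *: 1]mulr1 scalerDl addrCA.
apply: DeriveDef; last exact/cvg_lim.
by apply/cvg_ex; eexists; exact: cv.
Unshelve. all: by end_near. Qed.

(** The intermediate point may differ from one coordinate to the other, which is why the mean value
    theorem is applied to [p \o f] and not to [f]. *)
Lemma mean_value_line {R : realType} (p : R * R -> R) (f : R * R -> R * R)
    (x y : R * R) :
  continuous p -> (forall a u w, p (a *: (u - w)) = a * (p u - p w)) ->
  (forall z, differentiable f z) ->
  exists2 t, t \in `[0, 1]%R &
    p (f x) - p (f y) = p ('D_(x - y) f (y + t *: (x - y))).
Proof.
move=> cp lp df.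
have d (t : R) : is_derive t (1 : R) (fun s => p (f (y + s *: (x - y))))
    (p ('D_(x - y) f (y + t *: (x - y)))) by exact: is_derive_line.
have [|t t01] := @MVT_segment R (fun s => p (f (y + s *: (x - y)))) _ 0 1 ler01
   (fun t _ => d t).
  apply: continuous_subspaceT => t.
  by apply/differentiable_continuous/derivable1_diffP; apply: ex_derive.
rewrite subr0 mulr1 scale1r scale0r addr0 addrCA subrr addr0 => E.
by exists t.
Qed.

Lemma strict_differentiable {R : realType} (f : R * R -> R * R) (z : R * R)
    (e : R) : C1 f -> 0 < e ->
  exists2 r, 0 < r & forall x y, `|x - z| < r -> `|y - z| < r ->
    `|f x - f y - ((x - y).1 *: dx f z + (x - y).2 *: dy f z)| <= e * `|x - y|.
Proof.
move=> [df [cx cy]] e0.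
(* Half of [e] for each of the two partial derivatives. *)
have e20 : 0 < e / 2 by rewrite divr_gt0.
have : \forall u \near z, `|dx f z - dx f u| < e / 2 /\ `|dy f z - dy f u| < e / 2.
  have /cvgrPdist_lt hx : dx f u @[u --> z] --> dx f z by exact: cx.
  have /cvgrPdist_lt hy : dy f u @[u --> z] --> dy f z by exact: cy.
  exact: filterI (hx _ e20) (hy _ e20).
move=> /nbhs_normP[r /= r0 Hr]; exists r => // x y xr yr.
(* The estimate for one coordinate; since the product norm is the maximum, the two coordinates
   combine without loss. *)
have key (p : R * R -> R) : continuous p ->
    (forall a u w, p (a *: (u - w)) = a * (p u - p w)) ->
    (forall u, `|p u| <= `|u|) ->
  `|p (f x) - p (f y) - ((x - y).1 * p (dx f z) + (x - y).2 * p (dy f z))|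
    <= e * `|x - y|.
  move=> cp lp np.
  have lp0 a u : p (a *: u) = a * p u.
    have := lp 0 0 0; rewrite scale0r mul0r => p0.
    by have := lp a u 0; rewrite p0 !subr0.
  have lpB u w : p (u - w) = p u - p w.
    by have := lp 1 u w; rewrite scale1r mul1r.
  have lpD u w : p (u + w) = p u + p w.
    by rewrite -{1}[w]opprK lpB -[- w]scaleN1r lp0 mulN1r opprK.
  have [t + ->] := mean_value_line p f x y cp lp df.
  rewrite in_itv /= => /andP[t0 t1].
  set u := y + _.
  (* [u] lies on the segment from [y] to [x], hence in the ball by convexity. *)
  have ur : `|z - u| < r.
    rewrite distrC /u (_ : _ - z = t *: (x - z) + (1 - t) *: (y - z)).
      rewrite (le_lt_trans (ler_normD _ _))// !normrZ (ger0_norm t0).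
      rewrite (ger0_norm (_ : 0 <= 1 - t)) ?subr_ge0//.
      move: `|x - z| `|y - z| xr yr => a b ar br.
      by case: (lerP a b) => ab; nra.
    rewrite scalerBl scale1r addrCA -scalerBr.
    by rewrite opprB addrA subrK addrAC.
  have [hx hy] := Hr _ ur.
  rewrite (derive_pair f u _ (df u)).
  move: (dx f z) (dy f z) (dx f u) (dy f u) hx hy => a b a' b' ha hb.
  have := le_lt_trans (np _) ha; have := le_lt_trans (np _) hb.
  rewrite !lpB => np2 np1.
  have est (h k n : R) : `|h| <= n -> `|k| <= n ->
      `|h * p a' + k * p b' - (h * p a + k * p b)| <= e * n.
    move=> hn kn.
    have -> : h * p a' + k * p b' - (h * p a + k * p b) =
      - (h * (p a - p a') + k * (p b - p b')) by ring.
    rewrite normrN (le_trans (ler_normD _ _))// !normrM.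
    have := ler_pM (normr_ge0 _) (normr_ge0 _) hn (ltW np1).
    have := ler_pM (normr_ge0 _) (normr_ge0 _) kn (ltW np2).
    lra.
  rewrite lpD !lp0; apply: est.
  - by rewrite [leRHS]prod_normE le_max lexx.
  - by rewrite [leRHS]prod_normE le_max lexx orbT.
rewrite prod_normE ge_max; apply/andP; split.
- apply: (key fst) => //; first by move=> u; exact: cvg_fst.
  by move=> u; rewrite prod_normE le_max lexx.
- apply: (key snd) => //; first by move=> u; exact: cvg_snd.
  by move=> u; rewrite prod_normE le_max lexx orbT.
Qed.

(** * The inverse function theorem at a regular point *)

Lemma compact_norm_ball {R : realType} (c : R * R) (s : R) :
  compact [set x : R * R | `|x - c| <= s].
Proof.
rewrite (_ : mkset _ = `[c.1 - s, c.1 + s]%classic `*` `[c.2 - s, c.2 + s]%classic).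
  by apply: compact_setX; exact: segment_compact.
apply/seteqP; split => x /=; rewrite prod_normE ge_max !in_itv /= !ler_norml.
  by move=> /andP[/andP[? ?] /andP[? ?]]; split; lra.
by move=> [/andP[? ?] /andP[? ?]]; lra.
Qed.

Lemma C1_continuous {R : realType} (f : R * R -> R * R) : C1 f -> continuous f.
Proof. by move=> [df _] x; exact: differentiable_continuous. Qed.

(** Cramer's rule: [g] is the adjugate of the differential divided by its determinant. *)
Lemma differential_inverse {R : realType} (f : R * R -> R * R) (z : R * R) :
  jac f z != 0 ->
  exists K (g : R * R -> R * R),
    [/\ 0 < K, forall k, `|g k| <= K * `|k|,
     forall k, (g k).1 *: dx f z + (g k).2 *: dy f z = k &
     forall h, g (h.1 *: dx f z + h.2 *: dy f z) = h].
Proof.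
rewrite /jac; case: (dx f z) (dy f z) => a c [b d] /=.
set J := a * d - b * c => J0.
exists ((`|a| + `|b| + `|c| + `|d|) / `|J| + 1).
exists (fun k => ((d * k.1 - b * k.2) / J, (a * k.2 - c * k.1) / J)); split.
- by rewrite ltr_wpDl// divr_ge0// !addr_ge0.
- move=> k.
  have : `|k.1| <= `|k| /\ `|k.2| <= `|k|.
    by rewrite prod_normE !le_max !lexx orbT.
  move=> [k1 k2]; rewrite prod_normE ge_max /= !normrM !normfV.
  have n0 := normr_ge0 k.
  have J1 : 0 < `|J|^-1 by rewrite invr_gt0 normr_gt0.
  have P (u v x y : R) : `|x| <= `|k| -> `|y| <= `|k| ->
      `|u| + `|v| <= `|a| + `|b| + `|c| + `|d| ->
      `|u * x - v * y| / `|J| <= ((`|a| + `|b| + `|c| + `|d|) / `|J| + 1) * `|k|.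
    move=> xk yk uv; rewrite mulrDl mul1r [X in _ <= X + _]mulrAC.
    rewrite -[leLHS]addr0 lerD// ler_wpM2r ?(ltW J1)//.
    rewrite (le_trans (ler_normB _ _))// !normrM.
    rewrite (le_trans (lerD (ler_wpM2l _ xk) (ler_wpM2l _ yk)))// -mulrDl.
    exact: ler_wpM2r.
  have := (normr_ge0 a, normr_ge0 b, normr_ge0 c, normr_ge0 d).
  by move=> [[[? ?] ?] ?]; rewrite !P//; lra.
- move=> [k1 k2]; congr (_, _) => /=; rewrite /GRing.scale /= /J; field.
  + exact: J0. + exact: J0.
- move=> [h1 h2]; congr (_, _) => /=; rewrite /GRing.scale /= /J; field.
  + exact: J0. + exact: J0.
Qed.

(** With error constant 1/(2K), where K bounds the inverse of the differential, strict
    differentiability gives |x - y| <= 2K |f x - f y| near [z], hence injectivity. Existence is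
    stated for every smaller radius [s], so that preimages can later be sought in a ball smaller
    than the ball of injectivity. *)
Lemma local_inverse {R : realType} (f : R * R -> R * R) (z : R * R) :
  C1 f -> ~ crit f z ->
  exists2 r, 0 < r &
    (forall x y, `|x - z| < r -> `|y - z| < r -> f x = f y -> x = y) /\
    forall s, 0 < s -> s <= r ->
      \forall y \near f z, exists2 x, `|x - z| < s & f x = y.
Proof.
move=> Cf /eqP /differential_inverse[K [g [K0 gK Lg gL]]].
have e0 : 0 < (2 * K)^-1 by rewrite invr_gt0 mulr_gt0.
have [r r0 Hr] := strict_differentiable f z _ Cf e0.
have expand x y : `|x - z| < r -> `|y - z| < r ->
    `|x - y| <= 2 * K * `|f x - f y|.
  move=> xr yr.
  have := Hr _ _ xr yr; set l := _ *: _ + _ => h.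
  have h1 : `|x - y| <= K * `|l| by have := gK l; rewrite gL.
  have h2 : `|l| <= `|f x - f y| + `|f x - f y - l|.
    by rewrite -{1}[l](subKr (f x - f y)); exact: ler_normB.
  have h3 : K * ((2 * K)^-1 * `|x - y|) = `|x - y| / 2.
    by field; rewrite gt_eqF.
  have := ler_wpM2l (ltW K0) (le_trans h2 (lerD (lexx _) h)).
  rewrite mulrDr h3; lra.
exists r => //; split.
  move=> x y xr yr fxy; have := expand _ _ xr yr.
  by rewrite fxy subrr normr0 mulr0 normr_le0 subr_eq0 => /eqP.
move=> s s0 sr.
(* With K |f z - y| < s/10, a minimizer is within 4s/10 of [z] by the expansion bound, and a Newton
   step moves it by less than s/10, so it stays within s/2. *)
have d0 : 0 < s / (10 * K) by rewrite divr_gt0// mulr_gt0.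
apply/nbhs_normP; exists (s / (10 * K)) => //= y; set dl := `|f z - y| => hy.
have hK : K * dl < s / 10.
  by move: hy; rewrite /ball_/= -/dl ltr_pdivlMr ?mulr_gt0//; lra.
(* A Newton step from a minimizer of |f x - y| halves this quantity and stays in
   the ball, so the minimum is 0. *)
have := @compact_EVT_min _ R (fun x => `|f x - y|) [set x | `|x - z| <= s / 2].
case.
- by exists z => /=; rewrite subrr normr0; lra.
- exact: compact_norm_ball.
- apply: continuous_subspaceT => x; apply: cvg_norm; apply: cvgB; last exact: cvg_cst.
  exact: C1_continuous.
move=> x; rewrite inE /= => xs xmin.
have hx : `|f x - y| <= dl.
  by apply: xmin; rewrite inE /= subrr normr0; lra.
have xr : `|x - z| < r by lra.
have x4 : `|x - z| <= 4 * (K * dl).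
  have := expand x z xr; rewrite subrr normr0 => /(_ r0) /le_trans; apply.
  have : `|f x - f z| <= `|f x - y| + dl.
    by rewrite /dl (distrC (f z)) -(subrKA y) ler_normD.
  move=> h; nra.
pose x' := x - g (f x - y).
have x'x : `|x' - x| <= K * `|f x - y|.
  by rewrite /x' addrAC subrr add0r normrN.
have x's : `|x' - z| < s / 2.
  rewrite -(subrKA x) (le_lt_trans (ler_normD _ _))//.
  have := ler_wpM2l (ltW K0) hx; lra.
have x'r : `|x' - z| < r by lra.
have := Hr _ _ x'r xr.
rewrite (_ : (x' - x).1 *: _ + _ = - (f x - y)); last first.
  rewrite (_ : x' - x = - g (f x - y)); last by rewrite /x' addrAC subrr add0r.
  have := Lg (f x - y); move: (f x - y) (dx f z) (dy f z) => k a b E.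
  by rewrite -[in RHS]E opprD -!scaleNr.
rewrite opprK subrKA => h.
have : `|f x - y| <= `|f x' - y| by apply: xmin; rewrite inE /=; lra.
have : (2 * K)^-1 * (K * `|f x - y|) = `|f x - y| / 2 by field; rewrite gt_eqF.
have := ler_wpM2l (ltW e0) x'x.
move=> h1 h2 h3; exists x; first by rewrite /=; lra.
by apply/eqP; rewrite -subr_eq0 -normr_le0; lra.
Qed.

(** * Compactness, the cluster set at infinity, and closedness of the exceptional values *)

Lemma plane_nbhsP {R : realType} (z : R * R) (X : set (R * R)) :
  nbhs z X <-> exists2 r, 0 < r & [set x : R * R | `|x - z| < r] `<=` X.
Proof.
split=> [zX|[r r0 rX]].
  have /(nbhs_normP z X)[r r0 rX] : \forall x \near z, X x by exact: zX.
  by exists r => // x; rewrite /= distrC => /rX.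
suff : \forall x \near z, X x by [].
by apply/(nbhs_normP z X); exists r => // x; rewrite /ball_ /= distrC => /rX.
Qed.

Lemma near_notin_compact_image {R : realType} (f : R * R -> R * R)
    (K : set (R * R)) (w : R * R) :
  continuous f -> compact K -> (forall x, K x -> f x <> w) ->
  \forall y \near w, forall x, K x -> f x <> y.
Proof.
move=> cf cK Kw.
have cfK : closed (f @` K).
  apply: compact_closed; first exact: norm_hausdorff.
  by apply: continuous_compact => //; exact: continuous_subspaceT.
have : nbhs w (~` (f @` K)).
  apply: open_nbhs_nbhs; split; first exact: closed_openC.
  by move=> [x Kx fxw]; exact: Kw fxw.
by apply: filterS => y fKy x Kx fxy; apply: fKy; exists x.
Qed.

(** Otherwise, for each n, some x in [D] has |x| > n and f x within 1/(n+1) of [w]; this sequence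
    puts [w] in the cluster set. *)
Lemma bounded_preimages {R : realType} (f : R * R -> R * R)
    (D : set (R * R)) (w : R * R) :
  ~ cluster_infty f D w ->
  exists M, \forall y \near w, forall x, D x -> f x = y -> `|x| <= M.
Proof.
move=> ncl; apply: contrapT => /forallNP nM; apply: ncl.
have /choice[u Hu] : forall n : nat, exists x,
    [/\ D x, n%:R < `|x| & `|w - f x| < n.+1%:R^-1].
  move=> n; apply: contrapT => /forallNP nx; apply: (nM n%:R).
  apply/nbhs_normP; exists n.+1%:R^-1 => //= y wy x Dx fxy.
  rewrite leNgt; apply/negP => nltx; apply: (nx x); split => //.
  by rewrite fxy.
exists u; split; first by move=> n; have [] := Hu n.
split.
  move=> M; near=> n; have [_ + _] := Hu n; apply: lt_trans.
  by near: n; exact: nbhs_infty_gtr.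
apply/cvgrPdist_lt => e e0; near=> n => /=.
have [_ _ h] := Hu n; apply: (lt_trans h).
near: n; exact: (near_infty_natSinv_lt (PosNum e0)).
Unshelve. all: by end_near. Qed.

Lemma far_of_cluster {R : realType} (f : R * R -> R * R)
    (w : R * R) (V : set (R * R)) (M : R) :
  cluster_infty f setT w -> nbhs w V -> exists2 x, V (f x) & M < `|x|.
Proof.
move=> [u [_ [uoo uw]]] Vw.
have [n [Vn Mn]] : exists n, V (f (u n)) /\ M < `|u n|.
  by apply: (@filter_ex _ \oo); apply: filterI; [exact: uw|exact: uoo].
by exists (u n).
Qed.

Lemma cluster_infty_subset {R : realType} (f : R * R -> R * R) (D : set (R * R)) :
  cluster_infty f D `<=` cluster_infty f setT.
Proof. by move=> w [u [_ h]]; exists u. Qed.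

Lemma jac_continuous {R : realType} (f : R * R -> R * R) :
  C1 f -> continuous (jac f).
Proof.
move=> [_ [cx cy]] z.
have c1 (g : R * R -> R * R) : continuous g -> {for z, continuous (fun x => (g x).1)}.
  by move=> cg; exact: cvg_comp (cg z) cvg_fst.
have c2 (g : R * R -> R * R) : continuous g -> {for z, continuous (fun x => (g x).2)}.
  by move=> cg; exact: cvg_comp (cg z) cvg_snd.
by apply: cvgB; apply: cvgM; [exact: c1|exact: c2|exact: c1|exact: c2].
Qed.

(** Near a value off the set, all preimages lie in a fixed ball. The critical points in that ball
    form a compact set, whose image stays away from the value, and a cluster value would bring
    preimages outside the ball. *)
Lemma closed_crit_values_cluster {R : realType} (f : R * R -> R * R) :
  C1 f -> closed (f @` crit f `|` cluster_infty f setT).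
Proof.
move=> Cf; rewrite -openC openE => w /not_orP[nS nC].
have [M nM] := bounded_preimages f setT w nC.
have cf := C1_continuous f Cf.
have cK : compact ([set x : R * R | `|x - 0| <= M] `&` crit f).
  apply: compact_closedI; first exact: compact_norm_ball.
  apply: (preimage_closed (D := [set 0])) => [x _|]; first exact: jac_continuous.
  exact: closed_eq.
have nK := near_notin_compact_image f _ w cf cK.
have /nK {}nK : forall x, ([set x : R * R | `|x - 0| <= M] `&` crit f) x -> f x <> w.
  by move=> x [_ Sx] fxw; apply: nS; exists x.
have : nbhs w [set y | (forall x, setT x -> f x = y -> `|x| <= M) /\
   forall x, ([set x : R * R | `|x - 0| <= M] `&` crit f) x -> f x <> y].
  exact: filterI.
(* The bounds must hold on a whole neighborhood of [y]: membership of [y] in the cluster set only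
   yields distant points whose images are close to [y]. *)
rewrite /interior => /nbhs_interior nE; apply: filterS nE => y Vy.
have [By Ky] := nbhs_singleton Vy.
move=> [[x Sx fxy]|Cy].
  by apply: (Ky x) => //; split => //=; rewrite subr0; exact: By.
have [x [Bx _] Mx] := far_of_cluster f y _ M Cy Vy.
by have := Bx x I erefl; rewrite leNgt Mx.
Qed.

(** * Components of open sets in the plane *)

Lemma norm_ball_connected {R : realType} (c : R * R) (r : R) :
  connected [set x : R * R | `|x - c| < r].
Proof.
have [r0|r0] := ltP 0 r; last first.
  rewrite (_ : mkset _ = set0); first exact: connected0.
  by rewrite -subset0 => x /= /(le_lt_trans (normr_ge0 _)); rewrite ltNge r0.
(* The ball is the union of segments issuing from its center. *)
pose seg x := (fun t : R => c + t *: (x - c)) @` `[0, 1]%classic.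
rewrite (_ : mkset _ = \bigcup_(x in [set x : R * R | `|x - c| < r]) seg x).
  apply: bigcup_connected.
    by exists c => x _; exists 0; rewrite /= ?in_itv/= ?lexx ?ler01// scale0r addr0.
  move=> x _; apply: connected_continuous_connected; first exact: segment_connected.
  apply: continuous_subspaceT => t; apply: cvgD; first exact: cvg_cst.
  exact: cvgZr_tmp.
apply/seteqP; split => [x xr|x [y /= yr [t]]].
  exists x => //; exists 1; rewrite /= ?in_itv/= ?lexx ?ler01//.
  by rewrite scale1r addrCA subrr addr0.
rewrite /= in_itv /= => /andP[t0 t1] <-.
rewrite addrAC subrr add0r normrZ ger0_norm//.
by have := normr_ge0 (y - c); nra.
Qed.

(* Balls are connected, so a component of an open set absorbs every ball of
   the open set that it meets. *)
Lemma open_component_ball {R : realType} (X C : set (R * R)) :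
  open X -> is_component X C -> forall z, X z ->
  exists2 r, 0 < r & forall y, C y -> `|y - z| < r ->
    [set x : R * R | `|x - z| < r] `<=` C.
Proof.
move=> oX [x0 [_ ->]] z Xz.
have /plane_nbhsP[r r0 rX] : nbhs z X by exact: open_nbhs_nbhs.
exists r => // y Cy yr.
rewrite (same_connected_component Cy).
apply: connected_component_max => //; last exact: norm_ball_connected.
Qed.

Lemma component_open {R : realType} (X C : set (R * R)) :
  open X -> is_component X C -> open C.
Proof.
move=> oX cC; rewrite openE => z Cz.
have Xz : X z by case: cC Cz => x0 [_ ->]; exact: connected_component_sub.
have [r r0 rC] := open_component_ball X C oX cC z Xz.
apply/plane_nbhsP; exists r => //.
by apply: (rC z); rewrite ?subrr ?normr0.
Qed.

(** A ball about [z] inside [X] meets [C], so [C] absorbs it. *)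
Lemma component_closure {R : realType} (X C : set (R * R)) :
  open X -> is_component X C -> closure C `&` X `<=` C.
Proof.
move=> oX cC z [Cz Xz].
have [r r0 rC] := open_component_ball X C oX cC z Xz.
have /Cz[y [Cy /= yr]] : nbhs z [set x : R * R | `|x - z| < r].
  by apply/plane_nbhsP; exists r.
by apply: (rC y Cy yr); rewrite /= subrr normr0.
Qed.

(** * Cardinalities and the count of preimages near a value *)

Lemma ecard_eq {R : realType} {T U : Type} (A : set T) (B : set U) :
  (A #= B)%card -> ecard A = ecard B :> \bar R.
Proof.
move=> AB; rewrite /ecard; have := eq_finite_set AB.
case: pselect => fA; case: pselect => fB //.
- move=> _; case: cid => n An; case: cid => m Bm /=.
  (* The numbers inside [ecard] come from choice, but equipotent initial segments of the naturals
     have the same length. *)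
  congr (_%:R%:E); apply/card_eq_II.
  by rewrite -(card_eql An) (card_eql AB).
- by move=> E; case: fB; rewrite -E.
- by move=> E; case: fA; rewrite E.
Qed.

Lemma compact_discrete_finite {T : topologicalType} (K : set T) :
  compact K -> (forall x, K x -> exists2 U, nbhs x U & K `&` U `<=` [set x]) ->
  finite_set K.
Proof.
move=> /compact_near_coveringP cK dK.
(* The filter of large finite sets. Near x the only possible point of [K] is x itself, so every
   finite set containing x suffices there; compactness then gives one finite set containing [K]. *)
pose G : set_system (set T) :=
  filter_from finite_set (fun A => [set B | finite_set B /\ A `<=` B]).
have FG : Filter G.
  apply: filter_from_filter; first by exists set0.
  move=> A B fA fB; exists (A `|` B); first by rewrite finite_setU.
  by move=> C [fC ABC]; split; split => // x ?; apply: ABC; [left|right].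
have [|A fA AK] := cK _ G (fun A x => K x -> A x) FG; last first.
  by apply: (sub_finite_set _ fA) => x Kx; exact: (AK A (conj fA (@subset_refl _ A))).
move=> x Kx; have [U xU KU] := dK x Kx.
exists (U, [set B | B x]).
  split => //=; exists [set x]; first exact: finite_set1.
  by move=> B [_]; apply.
by move=> [x' B] [/= Ux' Bx] Kx'; rewrite (KU x').
Qed.

(** The bijection sends a preimage z of [w] to the preimage of y near z; the last hypothesis forces
    that point into [D] when y is in [W]. *)
Lemma card_preimages_near {R : realType} (f : R * R -> R * R)
    (D W : set (R * R)) (w : R * R) :
  C1 f -> ~ cluster_infty f D w ->
  (forall z, closure D z -> f z = w -> ~ crit f z) ->
  (forall z, closure D z -> f z = w ->
    exists U, nbhs z U /\ forall x, U x -> ~ D x -> ~ W (f x)) ->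
  \forall y \near w, W y ->
    ((D `&` f @^-1` [set y]) #= (closure D `&` f @^-1` [set w]))%card.
Proof.
move=> Cf ncl nS DW; set F := closure D `&` _.
have cf := C1_continuous f Cf.
have [M nM] := bounded_preimages f D w ncl.
(* Injectivity holds on the full ball, while the preimage is found in the half ball; this margin
   makes the half balls disjoint. The value 0 off [F] is a dummy. *)
have /choice[r Hr] : forall z, exists r : R, F z ->
   [/\ 0 < r,
       forall x y, `|x - z| < r -> `|y - z| < r -> f x = f y -> x = y,
       forall x, `|x - z| < r -> ~ D x -> ~ W (f x) &
       \forall y \near w, exists2 x, `|x - z| < r / 2 & f x = y].
  move=> z; have [[Dz fzw]|nFz] := pselect (F z); last by exists 0.
  have [r1 r10 [inj surj]] := local_inverse f z Cf (nS z Dz fzw).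
  have [U [/plane_nbhsP[r2 r20 r2U] UW]] := DW z Dz fzw.
  have [m0 m1 m2] : [/\ 0 < Num.min r1 r2, Num.min r1 r2 <= r1 & Num.min r1 r2 <= r2].
    by rewrite lt_min r10 r20 !ge_min !lexx orbT.
  exists (Num.min r1 r2) => _; split => //.
  - by move=> x y xm ym; apply: inj; [exact: lt_le_trans xm m1|exact: lt_le_trans ym m1].
  - by move=> x xm; apply: UW; apply: r2U => /=; exact: lt_le_trans xm m2.
  - by rewrite -fzw; apply: surj; [rewrite divr_gt0|lra].
pose B z := [set x : R * R | `|x - z| < r z / 2].
have rP z : F z -> 0 < r z by move=> /Hr[].
have oB z : open (B z).
  rewrite (_ : B z = ball z (r z / 2)); first exact: ball_open.
  by rewrite -ball_normE; apply/seteqP; split => x; rewrite /B /ball_ /= distrC.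
(* If two half balls meet, the full ball of larger radius contains both centers, which have the same
   image [w]. *)
have disj z z' x : F z -> F z' -> B z x -> B z' x -> z = z'.
  wlog le : z z' / r z' <= r z.
    move=> H Fz Fz' Bz Bz'; have [|/ltW] := leP (r z') (r z) => h.
      exact: H h Fz Fz' Bz Bz'.
    exact/esym/(H _ _ h Fz' Fz Bz' Bz).
  move=> Fz Fz'; rewrite /B /= => Bz Bz'.
  have [r0 inj _ _] := Hr z Fz; apply: inj.
  - by rewrite subrr normr0.
  - by rewrite -(subrKA x) (le_lt_trans (ler_normD _ _))// (distrC z'); lra.
  - by case: Fz Fz' => _ -> [_ ->].
(* The bound [M] concerns points of [D]; a point of the closure is within 1 of such a point. *)
have FM z : F z -> `|z| <= M + 1.
  move=> [Dz fzw].
  have nz : nbhs z (f @^-1` [set y | forall u, D u -> f u = y -> `|u| <= M]).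
    by apply: cf; rewrite fzw; exact: nM.
  have /Dz[x [Dx [/(_ x Dx erefl) xM /= xz]]] : nbhs z
      ((f @^-1` [set y | forall u, D u -> f u = y -> `|u| <= M]) `&`
      [set x : R * R | `|x - z| < 1]).
    by apply: filterI => //; apply/plane_nbhsP; exists 1.
  have := ler_normB x (x - z); rewrite opprB addrC subrK; lra.
pose K := [set x : R * R | `|x - 0| <= M + 1] `&` closure D.
have cK : compact K.
  by apply: compact_closedI; [exact: compact_norm_ball|exact: closed_closure].
have cF : compact F.
  rewrite (_ : F = K `&` f @^-1` [set w]).
    apply: compact_closedI => //; apply: preimage_closed => [x _|]; first exact: cf.
    by apply: compact_closed; [exact: norm_hausdorff|exact: compact_set1].
  apply/seteqP; split => [z Fz|z [[_ ?] ?]//].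
  by case: (Fz) => Dz fz; split => //; split => //=; rewrite subr0; exact: FM.
have Bzz z : F z -> B z z by move=> Fz; rewrite /B /= subrr normr0 divr_gt0// rP.
have finF : finite_set F.
  apply: compact_discrete_finite => // z Fz; exists (B z).
    by apply: open_nbhs_nbhs; split => //; exact: Bzz.
  by move=> z' [Fz' Bz']; exact: disj Fz' Fz (Bzz z' Fz') Bz'.
have cK' : compact (K `&` ~` (\bigcup_(z in F) B z)).
  by apply: compact_closedI => //; apply: open_closedC; exact: bigcup_open.
(* Off the half balls, the compact set [K] contains no preimage of [w], so its image there avoids a
   neighborhood of [w]. *)
have nK : \forall y \near w, forall x, D x -> f x = y -> exists2 z, F z & B z x.
  have : \forall y \near w, forall x, (K `&` ~` (\bigcup_(z in F) B z)) x -> f x <> y.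
    apply: near_notin_compact_image => // x [[_ Dx] nB] fxw; apply: nB.
    by exists x; [|apply: Bzz].
  move=> nK; apply: filterS (filterI nM nK) => y [My Ky] x Dx fxy.
  apply: contrapT => nB; apply: (Ky x) => //; split; last first.
    by move=> [z Fz Bzx]; apply: nB; exists z.
  split; last exact: subset_closure.
  by rewrite /= subr0; have := My x Dx fxy; lra.
(* Finiteness of [F] allows the neighborhoods of [w] to be intersected. *)
have nF : \forall y \near w, forall z, F z -> exists2 x, B z x & f x = y.
  have := @filter_bigI _ _ (fset_set F) (fun z => [set y | exists2 x, B z x & f x = y])
    (nbhs w) _.
  rewrite fset_setK// => H; apply: filterS (H _ _) => [y Hy z /Hy//|z].
  by rewrite in_fset_set// => /set_mem /Hr[].
apply: filterS (filterI nK nF) => y [Ky Fy] Wy.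
rewrite card_eq_sym; apply/card_set_bijP.
have /choice[h Hh] : forall z, exists x, F z -> B z x /\ f x = y.
  move=> z; have [/Fy[x Bx fx]|nFz] := pselect (F z); first by exists x.
  by exists 0.
have half z x : F z -> B z x -> `|x - z| < r z.
  by move=> /rP; rewrite /B /=; lra.
exists h; split.
- move=> z Fz; have [Bh fh] := Hh z Fz; split => //.
  apply: contrapT => nD; have [_ _ nW _] := Hr z Fz.
  by apply: (nW (h z)) => //; [exact: half|rewrite fh].
- move=> z z' /set_mem Fz /set_mem Fz' hzz'.
  have [Bh _] := Hh z Fz; have [Bh' _] := Hh z' Fz'.
  by apply: (disj z z' (h z)) => //; rewrite hzz'.
- move=> x [Dx fxy]; have [z Fz Bzx] := Ky x Dx fxy.
  have [Bh fh] := Hh z Fz; have [_ inj _ _] := Hr z Fz.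
  by exists z => //; apply: inj; [exact: half|exact: half|rewrite fh].
Qed.

(** * Constancy of the count over Omega and its value at the boundary point *)

Theorem theorem3p21 (R : realType) (f : R * R -> R * R)
  (Rg Omega : set (R * R)) (w : R * R) :
  C1 f ->
  is_component (~` (f @^-1` (f @` crit f `|` cluster_infty f setT))) Rg ->
  is_component (~` (f @` crit f `|` cluster_infty f setT)) Omega ->
  (exists z, Rg z /\ Omega (f z)) ->
  boundary Omega w ->
  ~ cluster_infty f Rg w ->
  f @^-1` [set w] `&` boundary Rg `&` crit f = set0 ->
  f @^-1` [set w] `&` boundary Rg !=set0 ->
  (forall zeta, f zeta = w -> boundary Rg zeta ->
     exists U, nbhs zeta U /\ (forall x, U x -> ~ Rg x -> ~ Omega (f x))) ->
  ecard (boundary Rg `&` f @^-1` [set w]) = Val f Rg Omega.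
Proof.
move=> Cf cRg cOm [z0 [Rz0 Oz0]] [cOw nOw] ncl nS _ Hiv.
have cf := C1_continuous f Cf.
have oE := closed_openC (closed_crit_values_cluster f Cf).
move: cRg cOm oE; set E := _ `|` _ => cRg cOm oE.
have oX : open (~` (f @^-1` E)).
  by rewrite preimage_setC; apply: open_comp => // x _; exact: cf.
have oR := component_open _ _ oX cRg.
have oO := component_open _ _ oE cOm.
have OE : Omega `<=` ~` E by case: cOm => y [_ ->]; exact: connected_component_sub.
(* The image of [Rg] is connected, avoids [E] and meets [Omega] at [f z0]. *)
have ROm x : Rg x -> Omega (f x).
  move=> Rx; have cOmz : Omega = connected_component (~` E) (f z0).
    by case: cOm Oz0 => y [_ ->] /same_connected_component.
  rewrite cOmz; apply: (@connected_component_max _ (~` E) (f @` Rg)).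
  - by exists z0.
  - move=> _ [u Ru <-]; case: cRg Ru => y [_ ->].
    by move=> /connected_component_sub.
  - apply: connected_continuous_connected; last exact: continuous_subspaceT.
    by case: cRg => y [_ ->]; exact: component_connected.
  - by exists x.
have nearO y0 : Omega y0 -> \forall y \near y0,
    ((Rg `&` f @^-1` [set y]) #= (Rg `&` f @^-1` [set y0]))%card.
  move=> Oy0; have nEy0 := OE _ Oy0.
  have clR z : closure Rg z -> f z = y0 -> Rg z.
    move=> cz fz; apply: (component_closure _ _ oX cRg); split => //.
    by rewrite /= /preimage /= fz.
  have nry0 : \forall y \near y0, Omega y ->
      ((Rg `&` f @^-1` [set y]) #= (closure Rg `&` f @^-1` [set y0]))%card.
    apply: card_preimages_near => //.
    - by move=> /cluster_infty_subset Cy0; apply: nEy0; right.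
    - by move=> z _ fz Sz; apply: nEy0; left; exists z.
    (* Here z is interior to [Rg], so with [Rg] itself as neighborhood the condition is vacuous. *)
    - move=> z cz fz; exists Rg; split => //.
      by apply: open_nbhs_nbhs; split => //; exact: clR.
  have eqF : closure Rg `&` f @^-1` [set y0] = Rg `&` f @^-1` [set y0].
    apply/seteqP; split => z [Rz fz]; split => //; first exact: clR.
    exact: subset_closure.
  move: nry0; rewrite eqF => nry0.
  by apply: filterS2 nry0 (open_nbhs_nbhs (conj oO Oy0)) => y; exact.
have const y0 y : Omega y0 -> Omega y ->
    ((Rg `&` f @^-1` [set y]) #= (Rg `&` f @^-1` [set y0]))%card.
  move=> Oy0; pose A := [set y | Omega y /\
    ((Rg `&` f @^-1` [set y]) #= (Rg `&` f @^-1` [set y0]))%card].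
  suff <- : A = Omega by case.
  (* [A] and its complement in [Omega] are both open by [nearO], and [Omega] is connected. *)
  have oA : open A.
    rewrite openE => u [Ou cu]; rewrite /interior.
    apply: filterS2 (nearO u Ou) (open_nbhs_nbhs (conj oO Ou)) => v cv Ov.
    by split => //; exact: card_eq_trans cv cu.
  have oA' : open (Omega `\` A).
    rewrite openE => u [Ou nAu]; rewrite /interior.
    apply: filterS2 (nearO u Ou) (open_nbhs_nbhs (conj oO Ou)) => v cv Ov.
    split => // -[_ cv0]; apply: nAu; split => //.
    by apply: card_eq_trans cv0; rewrite card_eq_sym.
  have : connected Omega by case: cOm => u [_ ->]; exact: component_connected.
  apply.
  - by exists y0; split => //; exact: card_eqxx.
  - by exists A => //; apply/seteqP; split => [u [Ou ?]|u []//].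
  - exists (~` (Omega `\` A)); first exact: open_closedC.
    apply/seteqP; split => u; first by move=> Au; split; [case: Au|move=> []].
    by move=> [Ou nA]; apply: contrapT => nAu; apply: nA.
have nOmw : ~ Omega w.
  by move=> Ow; apply: nOw; exact: open_nbhs_nbhs.
(* A preimage of [w] inside [Rg] would put [w] in [Omega]. *)
have bR z : closure Rg z -> f z = w -> boundary Rg z.
  move=> cz fz; split => // /interior_subset /ROm; rewrite fz; exact: nOmw.
have nearw : \forall y \near w, Omega y ->
    ((Rg `&` f @^-1` [set y]) #= (closure Rg `&` f @^-1` [set w]))%card.
  apply: card_preimages_near => // z cz fz; last by apply: Hiv => //; exact: bR.
  move=> Sz; suff : (set0 : set (R * R)) z by [].
  by rewrite -nS; split => //; split => //; exact: bR.
have [y [Oy cy]] := cOw _ nearw.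
have eq1 : ecard (boundary Rg `&` f @^-1` [set w]) =
    ecard (Rg `&` f @^-1` [set y]) :> \bar R.
  rewrite (_ : boundary Rg `&` _ = closure Rg `&` f @^-1` [set w]).
    by apply: ecard_eq; rewrite card_eq_sym; exact: cy.
  by apply/seteqP; split => z [bz fz]; split => //; [case: bz|exact: bR].
(* All counts over [Omega] agree, so the supremum runs over a single value. *)
rewrite eq1 /Val (_ : [set _ | _ in _] = [set ecard (Rg `&` f @^-1` [set y])]).
  by rewrite ereal_sup1.
apply/seteqP; split => [_ [u Ou <-]|_ ->]; last by exists y.
by apply: ecard_eq; exact: const.
Qed.
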